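(* Let $R$ be a commutative ring with identity $1\neq 0$ and let $n\ge 2$ be an integer. Then $\mathrm{diam}(\overline{\mathrm{APOG}}(M_{n}(R)))\ge 2$.
   Context: $M_n(R)$ is the ring of $n\times n$ matrices over $R$. For a ring $T$ with identity, $\mathrm{IPO}(T)$ is the set of all $A\subseteq T$ of the form $A=IJ$ where each of $I,J$ is a left or a right ideal of $T$; the product of additive subgroups is the set of finite sums of products. $\overline{\mathrm{APOG}}(T)$ is the undirected graph whose vertices are the nonzero $A\in\mathrm{IPO}(T)$ for which there is a nonzero $B\in\mathrm{IPO}(T)$ with $AB=0$ or $BA=0$; two distinct vertices $A,B$ are adjacent iff $AB=0$ or $BA=0$. $\mathrm{diam}$ is the supremum of the distances between vertices. *)

(* Defs.v *)
From HB Require Import structures.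
From mathcomp Require Import all_boot all_order all_algebra.
From mathcomp Require Import boolp classical_sets reals constructive_ereal ereal.
From mathcomp Require Import Rstruct.

Set Implicit Arguments.
Unset Strict Implicit.
Unset Printing Implicit Defensive.

Import Order.TTheory GRing.Theory Num.Theory.
Local Open Scope classical_set_scope.
Local Open Scope ring_scope.

Section Ideals.
Variable T : pzRingType.
Implicit Types A B I J : set T.

Definition additive_subgroup I : Prop :=
  I 0 /\ (forall x y, I x -> I y -> I (x - y)).

Definition left_ideal I : Prop :=
  additive_subgroup I /\ (forall t x, I x -> I (t * x)).

Definition right_ideal I : Prop :=
  additive_subgroup I /\ (forall t x, I x -> I (x * t)).

Definition onesided_ideal I : Prop := left_ideal I \/ right_ideal I.

Definition mul_set A B : set T :=
  [set x | exists (m : nat) (a b : 'I_m -> T),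
     (forall i, A (a i) /\ B (b i)) /\ x = \sum_(i < m) a i * b i].

Definition IPO : set (set T) :=
  [set A | exists I J,
     [/\ onesided_ideal I, onesided_ideal J & A = mul_set I J]].

Definition annihilate A B : Prop :=
  mul_set A B = [set 0] \/ mul_set B A = [set 0].

End Ideals.

(* Simple undirected graphs, possibly infinite, with vertices in a type U. *)
Record graph (U : Type) := Graph {
  vertex : set U;
  adj : U -> U -> Prop;
  adj_vertex : forall x y, adj x y -> vertex x /\ vertex y;
  adj_sym : forall x y, adj x y -> adj y x;
  adj_irrefl : forall x, ~ adj x x
}.

Fixpoint walk (U : Type) (G : graph U) (k : nat) (x y : U) : Prop :=
  if k is k'.+1 then exists z, adj G x z /\ walk G k' z y else x = y.

(* The infimum of the empty set is +oo: vertices in different components are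
   at infinite distance. *)
Definition dist (U : Type) (G : graph U) (x y : U) : \bar Rdefinitions.R :=
  ereal_inf [set (k%:R)%:E | k in [set k | walk G k x y]].

Definition diam (U : Type) (G : graph U) : \bar Rdefinitions.R :=
  ereal_sup [set d | exists x y, [/\ vertex G x, vertex G y & d = dist G x y]].

Section APOGbar.
Variable T : pzRingType.
Implicit Types A B : set T.

Definition APOGbar_vertex : set (set T) :=
  [set A | [/\ IPO A, A <> [set 0] &
     exists B, [/\ IPO B, B <> [set 0] & annihilate A B]]].

Definition APOGbar_adj A B : Prop :=
  [/\ APOGbar_vertex A, APOGbar_vertex B, A <> B & annihilate A B].

Lemma APOGbar_adj_vertex A B : APOGbar_adj A B -> APOGbar_vertex A /\ APOGbar_vertex B.
Proof. by case. Qed.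

Lemma APOGbar_adj_sym A B : APOGbar_adj A B -> APOGbar_adj B A.
Proof. by case=> vA vB /nesym neqBA [AB|BA]; split=> //; [right|left]. Qed.

Lemma APOGbar_adj_irrefl A : ~ APOGbar_adj A A.
Proof. by case. Qed.

End APOGbar.

Definition APOGbar (T : pzRingType) : graph (set T) :=
  Graph (@APOGbar_adj_vertex T) (@APOGbar_adj_sym T) (@APOGbar_adj_irrefl T).

(* Main.v *)
Require Import Defs.
From mathcomp Require Import all_boot all_order all_algebra.
From mathcomp Require Import boolp classical_sets reals constructive_ereal ereal.
From mathcomp Require Import Rstruct.

(** A graph with two distinct non-adjacent vertices has diameter at least 2,
    so it suffices to exhibit such a pair.  Any idempotent [e] of a ring [T]
    that is not central provides one, namely the right ideal [eT] and the left
    ideal [Te]: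
    - they are vertices, because [T(1 - e) * eT = 0] and [Te * (1 - e)T = 0]
      while [1 - e] is nonzero, [1] being central;
    - they are distinct, because [eT = Te] would give [et = ete = te] for every
      [t] ([eT_neq_Te]);
    - they are not adjacent, because both contain [e], hence each of their two
      products contains [e * e = e], which is nonzero.
    In a matrix ring of size at least 2 the matrix unit [E_00] is such an
    idempotent, since it does not commute with [E_01]. *)

Import Order.TTheory GRing.Theory Num.Theory.
Local Open Scope classical_set_scope.
Local Open Scope ring_scope.

(** Walks of length 0 join equal vertices and walks of length 1 join adjacent
    ones, so every walk between [x] and [y] has length at least 2. *)
Lemma diam_ge2 (U : Type) (G : graph U) (x y : U) :
  vertex G x -> vertex G y -> x <> y -> ~ adj G x y -> (2%:E <= diam G)%E.
Proof.
move=> Gx Gy neq_xy nadj_xy.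
apply: (@le_trans _ _ (dist G x y)); last first.
  by apply: ereal_sup_ubound; exists x, y.
apply: le_ereal_inf_tmp => _ [[|[|k]] /= walk_xy <-].
- by [].
- by case: walk_xy => z [adj_xz eq_zy]; rewrite eq_zy in adj_xz.
- by rewrite lee_fin ler_nat.
Qed.

Section SetProducts.
Variable T : pzRingType.
Implicit Types (A B I : set T) (a b : T).

Lemma mem_mul_set A B a b : A a -> B b -> mul_set A B (a * b).
Proof.
by move=> Aa Bb; exists 1%N, (fun=> a), (fun=> b); rewrite big_ord1.
Qed.

Lemma mul_set_eq0 A B :
  (forall a b, A a -> B b -> a * b = 0) -> mul_set A B = [set 0].
Proof.
move=> AB0; apply/seteqP; split=> [_ [m [a [b [ABab ->]]]]|_ ->] /=.
  by apply: big1 => i _; have [Aa Bb] := ABab i; exact: AB0.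
by exists 0%N, (fun=> 0), (fun=> 0); split=> [[]|] //; rewrite big_ord0.
Qed.

Lemma additive_subgroup_sum I m (f : 'I_m -> T) :
  additive_subgroup I -> (forall i, I (f i)) -> I (\sum_(i < m) f i).
Proof.
move=> [I0 IB] If; apply: (big_ind I) => // x y Ix Iy.
(* Only closure under differences is given: [x + y = x - (0 - y)]. *)
by rewrite -[y]opprK -[- y]sub0r; exact: IB _ _ Ix (IB _ _ I0 Iy).
Qed.

Lemma left_ideal_setT : left_ideal [set: T].
Proof. by []. Qed.

(** A right ideal [I] is the product [I * T], as [T] has an identity. *)
Lemma right_ideal_IPO I : right_ideal I -> IPO I.
Proof.
move=> rI; exists I, setT; split; [by right|by left; exact: left_ideal_setT|].
case: rI => sI IM; apply/seteqP; split=> [x Ix|_ [m [a [b [ab ->]]]]].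
  by rewrite -[x]mulr1; exact: mem_mul_set.
by apply: additive_subgroup_sum => // i; apply: IM; case: (ab i).
Qed.

(** Symmetrically, a left ideal [I] is the product [T * I]. *)
Lemma left_ideal_IPO I : left_ideal I -> IPO I.
Proof.
move=> lI; exists setT, I; split; [by left; exact: left_ideal_setT|by left|].
case: lI => sI IM; apply/seteqP; split=> [x Ix|_ [m [a [b [ab ->]]]]].
  by rewrite -[x]mul1r; exact: mem_mul_set.
by apply: additive_subgroup_sum => // i; apply: IM; case: (ab i).
Qed.

Lemma not_annihilate_idem A B e :
  e * e = e -> e <> 0 -> A e -> B e -> ~ annihilate A B.
Proof.
move=> ee e_neq0 Ae Be.
by case=> AB0; apply: e_neq0;
  [have := mem_mul_set _ _ _ _ Ae Be|have := mem_mul_set _ _ _ _ Be Ae];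
  rewrite AB0 ee.
Qed.

End SetProducts.

Section Idempotents.
Variable T : pzRingType.
Implicit Types e t x : T.

(** For an idempotent [e] this is the right ideal [eT]; describing it by fixed
    points makes membership an equation. *)
Definition eT e : set T := [set x | e * x = x].

(** Likewise the left ideal [Te]. *)
Definition Te e : set T := [set x | x * e = x].

Lemma eT_IPO e : IPO (eT e).
Proof.
apply: right_ideal_IPO; split; first split; rewrite /eT /=.
- exact: mulr0.
- by move=> x y ex ey; rewrite mulrBr ex ey.
- by move=> t x ex; rewrite mulrA ex.
Qed.

Lemma Te_IPO e : IPO (Te e).
Proof.
apply: left_ideal_IPO; split; first split; rewrite /Te /=.
- exact: mul0r.
- by move=> x y xe ye; rewrite mulrBl xe ye.
- by move=> t x xe; rewrite -mulrA xe.
Qed.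

Lemma idem_compl e : e * e = e -> (1 - e) * (1 - e) = 1 - e.
Proof. by move=> ee; rewrite mulrBl mul1r mulrBr mulr1 ee subrr subr0. Qed.

Lemma mul_Te_eT_compl e : e * e = e -> mul_set (Te e) (eT (1 - e)) = [set 0].
Proof.
move=> ee; apply: mul_set_eq0 => x y <- <-.
by rewrite mulrA -(mulrA x) mulrBr mulr1 ee subrr mulr0 mul0r.
Qed.

Lemma neq_set0 (A : set T) e : A e -> e <> 0 -> A <> [set 0].
Proof. by move=> Ae e_neq0 A0; apply: e_neq0; rewrite A0 in Ae. Qed.

Lemma Te_vertex e : e * e = e -> e <> 0 -> 1 - e <> 0 -> APOGbar_vertex (Te e).
Proof.
move=> ee e0 f0; split; [exact: Te_IPO|exact: (neq_set0 _ e)|].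
exists (eT (1 - e)); split; [exact: eT_IPO| |by left; exact: mul_Te_eT_compl].
by apply: (neq_set0 _ (1 - e)) => //; exact: idem_compl.
Qed.

Lemma eT_vertex e : e * e = e -> e <> 0 -> 1 - e <> 0 -> APOGbar_vertex (eT e).
Proof.
move=> ee e0 f0; split; [exact: eT_IPO|exact: (neq_set0 _ e)|].
exists (Te (1 - e)); split; first exact: Te_IPO.
  by apply: (neq_set0 _ (1 - e)) => //; exact: idem_compl.
right; have := mul_Te_eT_compl _ (idem_compl _ ee).
by rewrite subKr.
Qed.

(** If [eT = Te], then [et], lying in [Te], and [te], lying in [eT], are both
    equal to [ete]. *)
Lemma eT_neq_Te e t : e * e = e -> e * t <> t * e -> eT e <> Te e.
Proof.
move=> ee et_neq eTTe; apply: et_neq.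
have et_Te : Te e (e * t) by rewrite -eTTe /eT /= mulrA ee.
have te_eT : eT e (t * e) by rewrite eTTe /Te /= -mulrA ee.
by rewrite -et_Te -[RHS]te_eT mulrA.
Qed.

Lemma diam_APOGbar_ge2 e t :
  e * e = e -> e * t <> t * e -> (2%:E <= diam (APOGbar T))%E.
Proof.
move=> ee et_neq.
have e0 : e <> 0 by move=> e0; apply: et_neq; rewrite e0 mul0r mulr0.
have f0 : 1 - e <> 0.
  by move=> /subr0_eq e1; apply: et_neq; rewrite -e1 mul1r mulr1.
apply: (@diam_ge2 _ (APOGbar T) (eT e) (Te e)).
- exact: eT_vertex.
- exact: Te_vertex.
- exact: eT_neq_Te et_neq.
- by case=> _ _ _; exact: (@not_annihilate_idem _ _ _ e).
Qed.

End Idempotents.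

Theorem proposition4p1 (R : comNzRingType) (n : nat) (hn : (2 <= n)%N) :
  (2%:E <= diam (APOGbar 'M[R]_n))%E.
Proof.
case: n hn => [|[|n]] // _.
pose i0 : 'I_n.+2 := ord0; pose i1 : 'I_n.+2 := lift ord0 ord0.
apply: (@diam_APOGbar_ge2 _ (delta_mx i0 i0) (delta_mx i0 i1)).
  exact: mul_delta_mx.
have -> : delta_mx i0 i0 * delta_mx i0 i1 = delta_mx i0 i1 :> 'M[R]_n.+2.
  exact: mul_delta_mx.
have -> : delta_mx i0 i1 * delta_mx i0 i0 = 0 :> 'M[R]_n.+2.
  exact: mul_delta_mx_0.
by move/matrixP/(_ i0 i1); rewrite !mxE !eqxx => /eqP; rewrite oner_eq0.
Qed.
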